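(* Let $L,M$ be locales and let $f\colon L\to M$ be an arbitrary function. Define $f_{\mathfrak c}^{\to}\colon \mathfrak c L\to\mathfrak c M$ by $f_{\mathfrak c}^{\to}(\mathfrak c(a))=\mathrm{cl}(f[\mathfrak c(a)])$ and $f_{\mathfrak c}^{\leftarrow}\colon \mathfrak c M\to\mathfrak c L$ by $f_{\mathfrak c}^{\leftarrow}(\mathfrak c(b))=\mathrm{cl}(f^{-1}[\mathfrak c(b)])$. Then $f$ is a localic map if and only if the following three conditions hold: (1) $(f_{\mathfrak c}^{\to},f_{\mathfrak c}^{\leftarrow})$ is an adjoint pair, i.e. $f_{\mathfrak c}^{\to}\dashv f_{\mathfrak c}^{\leftarrow}$; (2) $f_{\mathfrak c}^{\leftarrow}(\mathsf O)=\mathsf O$; (3) $\big(f_{\mathfrak c}^{\leftarrow}(\mathfrak c(b))\big)^{\mathsf c}\subseteq f^{-1}[\mathfrak o(b)]$ for every $b\in M$.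
   Context: A locale (= frame) is a complete lattice $L$ with $(\bigvee A)\wedge b=\bigvee\{a\wedge b\mid a\in A\}$ for all $A\subseteq L$, $b\in L$; it has a Heyting operation $\to$ with $a\wedge b\le c\iff a\le b\to c$. A frame homomorphism preserves all joins and all finite meets (including $0$ and $1$). A localic map $f\colon L\to M$ is a right adjoint of a frame homomorphism $M\to L$. For $a\in L$: $\mathfrak c(a)=\{x\in L\mid x\ge a\}$ (closed sublocale), $\mathfrak o(a)=\{x\in L\mid a\to x=x\}=\{a\to x\mid x\in L\}$ (open sublocale). $\mathsf O=\{1\}=\mathfrak c(1)=\mathfrak o(0)$ is the void sublocale (of either locale). Complements $(-)^{\mathsf c}$ are taken in the lattice of sublocales, so $\mathfrak c(a)^{\mathsf c}=\mathfrak o(a)$ and $\mathfrak o(a)^{\mathsf c}=\mathfrak c(a)$. $\mathfrak c L=\{\mathfrak c(a)\mid a\in L\}$, ordered by inclusion. For any subset $S\subseteq L$, $\mathrm{cl}\,S=\mathfrak c(\bigwedge S)$. For posets $X,Y$, a pair $(g,h)$ of order-preserving maps $g\colon X\to Y$, $h\colon Y\to X$ is an adjoint pair, $g\dashv h$, if $g(x)\le y\iff x\le h(y)$ for all $x\in X$, $y\in Y$. *)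

(* Defs.v *)
From HB Require Import structures.
From mathcomp Require Import all_boot all_order.
From mathcomp Require Import boolp classical_sets.

Set Implicit Arguments.
Unset Strict Implicit.
Unset Printing Implicit Defensive.

Import Order.TTheory.
Local Open Scope classical_set_scope.

(* The order, meet, top and bottom come from the bounded lattice T, and
   [bigjoin_supremum] makes it complete: arbitrary meets are derived in
   [bigmeet] below.  The boolean order and the choice structure of
   MathComp lattices are no restriction in classical logic. *)
HB.mixin Record TBLattice_isFrame d T of Order.TBLattice d T := {
  bigjoin : set T -> T;
  bigjoin_supremum : forall A : set T, supremums A (bigjoin A);
  meet_bigjoinl : forall (A : set T) (b : T),
    Order.meet (bigjoin A) b = bigjoin [set Order.meet a b | a in A]
}.

#[short(type="frameType")]
HB.structure Definition Frame d :=
  { T of TBLattice_isFrame d T & Order.TBLattice d T }.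

Section FrameOperations.
Context {d : Order.disp_t} {L : frameType d}.
Implicit Types (a b c x : L) (A S : set L).

Definition bigmeet A : L := bigjoin (lbound A).

Definition heyting a b : L := bigjoin [set c | (Order.meet a c <= b)%O].

Lemma bigjoin_ub A x : A x -> (x <= bigjoin A)%O.
Proof. by have [ub _] := bigjoin_supremum A; apply: ub. Qed.

Lemma bigjoin_le A b : (forall x, A x -> (x <= b)%O) -> (bigjoin A <= b)%O.
Proof. by have [_ lb] := bigjoin_supremum A => Ab; apply: lb => x /Ab. Qed.

Lemma bigmeet_lb A x : A x -> (bigmeet A <= x)%O.
Proof. by move=> Ax; apply: bigjoin_le => y; apply. Qed.

Lemma bigmeet_ge A b : (forall x, A x -> (b <= x)%O) -> (b <= bigmeet A)%O.
Proof. by move=> Ab; apply: bigjoin_ub => x /Ab. Qed.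

Lemma bigmeet_infimum A : infimums A (bigmeet A).
Proof.
by split=> [x|b lbb]; [exact: bigmeet_lb|apply: bigmeet_ge => x /lbb].
Qed.

Lemma le_heyting a b c : (c <= heyting a b)%O = (Order.meet a c <= b)%O.
Proof.
apply/idP/idP => [cab|]; last exact: bigjoin_ub.
apply: (le_trans (leI2 (lexx a) cab)); rewrite meetC meet_bigjoinl.
by apply: bigjoin_le => _ [x abx <-]; rewrite meetC.
Qed.

Definition is_sublocale S :=
  (forall A, A `<=` S -> S (bigmeet A)) /\ (forall a s, S s -> S (heyting a s)).

Definition closedsl a : set L := [set x | (a <= x)%O].

Definition opensl a : set L := [set x | heyting a x = x].

Definition voidsl : set L := [set \top%O].

(* Meets of sublocales are intersections, the bottom sublocale is
   [voidsl] and the top one is [setT]. *)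
Definition sljoin S T : set L := smallest is_sublocale (S `|` T).

Definition is_slcompl S T :=
  [/\ is_sublocale T, S `&` T = voidsl & sljoin S T = setT].

(* The value [setT] on sublocales without a complement is junk; see
   [slcompl_closedsl] and [slcompl_opensl] for the relevant cases. *)
Definition slcompl S : set L := xget setT [set T | is_slcompl S T].

Definition closedSub : Type := set_type (range (closedsl : L -> set L)).

Definition closed_of a : closedSub :=
  exist _ (closedsl a) (mem_set (imageT closedsl a)).

Lemma voidsl_closed : voidsl = closedsl (\top%O : L).
Proof.
rewrite /voidsl /closedsl; apply/seteqP; split=> x /= => [->|x1] //.
by apply/eqP; rewrite eq_le lex1 x1.
Qed.

Lemma range_voidsl : range (closedsl : L -> set L) voidsl.
Proof. by exists \top%O => //; rewrite voidsl_closed. Qed.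

Definition closed_void : closedSub := exist _ voidsl (mem_set range_voidsl).

(* S need not be a sublocale. *)
Definition slcl S : closedSub := closed_of (bigmeet S).

End FrameOperations.

Arguments closedSub {d} L.
Arguments closed_void {d} L.

HB.instance Definition _ d (L : frameType d) := Choice.on (closedSub L).
HB.instance Definition _ d (L : frameType d) :=
  SubType.copy (closedSub L) (set_type (range (@closedsl d L))).
HB.instance Definition _ d (L : frameType d) :=
  [SubChoice_isSubPOrder of closedSub L by <: with set_display].

Lemma le_closedSub d (L : frameType d) (S T : closedSub L) :
  (S <= T)%O = (val S `<=` val T) :> Prop.
Proof. by rewrite -Order.le_val subsetEset. Qed.

Section ComplementFacts.
Context {d : Order.disp_t} {L : frameType d}.
Implicit Types (a b x t : L) (S T : set L).

Lemma le_ext x t : (forall c, (c <= x)%O = (c <= t)%O) -> x = t.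
Proof. by move=> xt; apply: le_anti; rewrite -xt lexx xt lexx. Qed.

Lemma heyting_meet a x t :
  heyting a (Order.meet x t) = Order.meet (heyting a x) (heyting a t).
Proof. by apply: le_ext => c; rewrite lexI !le_heyting lexI. Qed.

Lemma heyting_heyting a b x :
  heyting a (heyting b x) = heyting (Order.meet a b) x.
Proof.
by apply: le_ext => c; rewrite !le_heyting meetA [Order.meet b a]meetC.
Qed.

Lemma heyting_idem a x : heyting a (heyting a x) = heyting a x.
Proof. by rewrite heyting_heyting meetxx. Qed.

Lemma le_heytingr a x : (x <= heyting a x)%O.
Proof. by rewrite le_heyting leIr. Qed.

Lemma heyting_eq1 a x : (a <= x)%O -> heyting a x = \top%O.
Proof. by move=> ax; apply/eqP; rewrite -le1x le_heyting meetx1. Qed.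

Lemma closedsl_sublocale a : is_sublocale (closedsl a).
Proof.
split=> [A Aa|b s as_]; first by apply: bigmeet_ge => x /Aa.
exact: le_trans as_ (le_heytingr b s).
Qed.

Lemma opensl_sublocale a : is_sublocale (opensl a).
Proof.
split=> [A Aa|b s as_]; last first.
  by rewrite /opensl /= heyting_heyting meetC -heyting_heyting as_.
apply/eqP; rewrite eq_le le_heytingr andbT.
apply: bigmeet_ge => x Ax; rewrite -(Aa x Ax) le_heyting.
by apply: le_trans (bigmeet_lb Ax); rewrite -le_heyting.
Qed.

Lemma sljoinE S T : is_sublocale S -> is_sublocale T ->
  sljoin S T = [set x | exists s t, [/\ S s, T t & x = Order.meet s t]].
Proof.
move=> [Sm Sh] [Tm Th]; apply/seteqP; split.
  apply: smallest_sub; last first.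
    have top (R : set L) : (forall A, A `<=` R -> R (bigmeet A)) -> R \top%O.
      move=> Rm; suff <- : bigmeet set0 = \top%O :> L by apply: Rm.
      by apply/eqP; rewrite -le1x; apply: bigmeet_ge.
    move=> x [Sx|Tx]; [exists x, \top%O|exists \top%O, x].
      by split; rewrite ?meetx1 //; apply: top.
    by split; rewrite ?meet1x //; apply: top.
  split=> [A Aj|b _ [s [t [Ss Tt ->]]]]; last first.
    by exists (heyting b s), (heyting b t); split; rewrite ?heyting_meet; auto.
  exists (bigmeet [set s | S s /\ (bigmeet A <= s)%O]).
  exists (bigmeet [set t | T t /\ (bigmeet A <= t)%O]); split.
  - by apply: Sm => ? [].
  - by apply: Tm => ? [].
  apply/eqP; rewrite eq_le lexI; apply/andP; split.
    by apply/andP; split; apply: bigmeet_ge => ? [].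
  apply: bigmeet_ge => x Ax; have [s [t [Ss Tt xE]]] := Aj x Ax.
  have /andP[As At] : (bigmeet A <= s)%O && (bigmeet A <= t)%O.
    by rewrite -lexI -xE; apply: bigmeet_lb.
  by rewrite xE; apply: leI2; apply: bigmeet_lb.
move=> _ [s [t [Ss Tt ->]]] R [[Rm _] STR].
suff -> : Order.meet s t = bigmeet [set s; t].
  by apply: Rm => x [->|->]; apply: STR; [left|right].
apply/eqP; rewrite eq_le; apply/andP; split.
  by apply: bigmeet_ge => x [->|->]; [exact: leIl|exact: leIr].
by rewrite lexI; apply/andP; split; apply: bigmeet_lb; [left|right].
Qed.

Lemma closed_open_join a x :
  x = Order.meet (Order.join a x) (heyting a x).
Proof.
apply/eqP; rewrite eq_le lexI leUr le_heytingr /=.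
rewrite meetC -le_heyting leUx !le_heyting meetC -le_heyting lexx /=.
exact: leIr.
Qed.

Lemma closed_open_meet a : closedsl a `&` opensl a = voidsl.
Proof.
apply/seteqP; split=> x /= => [[ax xE]|->].
  by rewrite /voidsl /= -xE heyting_eq1.
by split; [exact: lex1|rewrite /opensl /= heyting_eq1 // lex1].
Qed.

Lemma slcompl_closedsl a : slcompl (closedsl a) = opensl a.
Proof.
apply: xget_unique.
  split; [exact: opensl_sublocale|exact: closed_open_meet|].
  rewrite sljoinE; [|exact: closedsl_sublocale|exact: opensl_sublocale].
  apply/seteqP; split=> // x _; exists (Order.join a x), (heyting a x).
  by split; [exact: leUl|exact: heyting_idem|exact: closed_open_join].
move=> T [Tsl Tmeet]; rewrite sljoinE //; last exact: closedsl_sublocale.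
move=> Tjoin; apply/seteqP; split=> [t Tt|x ox].
  have : (closedsl a `&` T) (heyting (heyting a t) t).
    split; last by case: Tsl => _; apply.
    by rewrite /closedsl /= le_heyting meetC -le_heyting lexx.
  rewrite Tmeet /voidsl /= => h1; apply/eqP; rewrite eq_le le_heytingr andbT.
  by rewrite -[X in (X <= _)%O]meetx1 -le_heyting h1.
have : [set: L] x by [].
rewrite -Tjoin => -[u [t [au Tt xE]]].
by rewrite -ox xE heyting_meet heyting_eq1 // meet1x; case: Tsl => _; apply.
Qed.

Lemma slcompl_opensl a : slcompl (opensl a) = closedsl a.
Proof.
apply: xget_unique.
  split; [exact: closedsl_sublocale|by rewrite setIC closed_open_meet|].
  rewrite sljoinE; [|exact: opensl_sublocale|exact: closedsl_sublocale].
  apply/seteqP; split=> // x _; exists (heyting a x), (Order.join a x).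
  split; [exact: heyting_idem|exact: leUl|].
  by rewrite meetC -closed_open_join.
move=> T [Tsl Tmeet]; rewrite sljoinE //; last exact: opensl_sublocale.
move=> Tjoin; apply/seteqP; split=> [t Tt|x ax].
  have : (opensl a `&` T) (heyting a t).
    by split; [exact: heyting_idem|case: Tsl => _; apply].
  rewrite Tmeet /voidsl /= => h1.
  by rewrite /closedsl /= -[X in (X <= _)%O]meetx1 -le_heyting h1.
have : [set: L] x by [].
rewrite -Tjoin => -[u [t [ou Tt xE]]].
suff u1 : u = \top%O by rewrite xE u1 meet1x.
by rewrite -ou heyting_eq1 //; apply: le_trans ax _; rewrite xE leIl.
Qed.

End ComplementFacts.

Definition adjoint_pair dX dY (X : porderType dX) (Y : porderType dY)
    (g : X -> Y) (h : Y -> X) :=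
  [/\ {homo g : x y / (x <= y)%O}, {homo h : x y / (x <= y)%O}
    & forall x y, (g x <= y)%O <-> (x <= h y)%O].

Definition frame_hom dM dL (M : frameType dM) (L : frameType dL) (h : M -> L) :=
  [/\ forall A : set M, h (bigjoin A) = bigjoin (h @` A),
      {morph h : x y / Order.meet x y}, h \bot%O = \bot%O & h \top%O = \top%O].

Definition localic_map dL dM (L : frameType dL) (M : frameType dM)
    (f : L -> M) :=
  exists2 h : M -> L, frame_hom h & adjoint_pair h f.

Section ClosedImages.
Context {dL dM : Order.disp_t} {L : frameType dL} {M : frameType dM}.
Variable f : L -> M.

Definition closed_image (S : closedSub L) : closedSub M := slcl (f @` val S).

Definition closed_preimage (T : closedSub M) : closedSub L :=
  slcl (f @^-1` val T).

End ClosedImages.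

(* Main.v *)
Require Import Defs.
From mathcomp Require Import all_boot all_order.
From mathcomp Require Import boolp classical_sets.

Local Open Scope classical_set_scope.

(** Write [h b] for the meet of [{x | b <= f x}] and [g a] for the meet of
    [f[c(a)]].  Closed sublocales are ordered opposite to their generators, so
    condition (1) says that [h] is left adjoint to [g], and this already forces
    [h] to be left adjoint to [f].  Given that, (2) is preservation of the top
    and (3) is preservation of binary meets: [b -> f x = f x] for [x] of the
    form [h b -> h (b /\ c)] transposes to [h b /\ h c <= h (b /\ c)]. *)

Import Order.TTheory.

Section ClosedSublocales.
Context {d : Order.disp_t} {L : frameType d}.
Implicit Types (a b : L) (S : closedSub L).

Lemma le_closed_of a b : (closed_of a <= closed_of b)%O = (b <= a)%O.
Proof.
apply/idP/idP => [|ba]; first by rewrite le_closedSub => /(_ a (lexx a)).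
by rewrite le_closedSub => x; apply: le_trans.
Qed.

Lemma closed_of_inj : injective (@closed_of d L).
Proof. by move=> a b ab; apply: le_anti; rewrite -!le_closed_of ab lexx. Qed.

Lemma closed_voidE : closed_void L = closed_of \top%O.
Proof. by apply: val_inj; exact: voidsl_closed. Qed.

Lemma closedSubP S : exists a, S = closed_of a.
Proof.
have [a _ aS] := set_mem (valP S).
by exists a; apply: val_inj.
Qed.

Lemma bigmeet_closedsl a : bigmeet (closedsl a) = a.
Proof.
by apply: le_anti; rewrite bigmeet_lb ?bigmeet_ge // /closedsl /=.
Qed.

End ClosedSublocales.

Section AdjointPairs.
Context {dX dY : Order.disp_t} {X : porderType dX} {Y : porderType dY}.

(** Monotonicity comes for free from the unit [x <= h (g x)] and the counit [g (h y) <= y]. *)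
Lemma adjoint_pair_iff (g : X -> Y) (h : Y -> X) :
  (forall x y, (g x <= y)%O <-> (x <= h y)%O) -> adjoint_pair g h.
Proof.
move=> gh; split=> [x y xy|x y xy|//].
  by apply/gh; apply: le_trans xy _; apply/gh.
by apply/gh; apply: le_trans xy; apply/gh.
Qed.

End AdjointPairs.

Section LeftAdjoints.
Context {dL dM : Order.disp_t} {L : frameType dL} {M : frameType dM}.
Context {f : L -> M} {h : M -> L}.
Hypothesis hf : forall b a, (h b <= a)%O <-> (b <= f a)%O.

Lemma left_adjoint_bigjoin (A : set M) : h (bigjoin A) = bigjoin (h @` A).
Proof.
apply: le_anti; apply/andP; split.
  apply/hf; apply: bigjoin_le => b Ab; apply/hf.
  by apply: bigjoin_ub; exists b.
apply: bigjoin_le => _ [b Ab <-]; apply/hf.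
by apply: le_trans (bigjoin_ub Ab) _; apply/hf.
Qed.

Lemma left_adjoint_bot : h \bot%O = \bot%O.
Proof. by apply/eqP; rewrite -lex0; apply/hf; exact: le0x. Qed.

Lemma left_adjoint_meetP :
  {morph h : b c / Order.meet b c} <->
  (forall b, opensl (h b) `<=` f @^-1` opensl b).
Proof.
split=> [hI b x ox|of_h b c].
  (* Both sides have the same lower bounds [c]: transposed along [hf], the two inequalities are
     [h b /\ h c <= x] and [h c <= x], which agree because [heyting (h b) x = x]. *)
  rewrite /preimage /opensl /=; apply: le_ext => c.
  rewrite le_heyting; apply/idP/idP => [/hf|/hf hcx].
    by rewrite hI -le_heyting ox => /hf.
  by apply/hf; rewrite hI -le_heyting ox.
apply: le_anti; apply/andP; split.
  by rewrite lexI; apply/andP; split; apply/hf; [apply: le_trans (leIl _ _) _|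
    apply: le_trans (leIr _ _) _]; apply/hf.
rewrite -le_heyting; apply/hf.
(* Used backwards, the fixed-point equation puts [heyting b] in front of [f], so that [b] can join
   [c] on the left. *)
rewrite -(of_h b (heyting (h b) (h (Order.meet b c))) (heyting_idem _ _)).
by rewrite le_heyting; apply/hf; exact: le_heytingr.
Qed.

End LeftAdjoints.

Section ClosedImageAdjunction.
Context {dL dM : Order.disp_t} {L : frameType dL} {M : frameType dM}.
Context (f : L -> M).

Definition preimage_meet (b : M) : L := bigmeet (f @^-1` closedsl b).

Lemma closed_preimage_of b :
  closed_preimage f (closed_of b) = closed_of (preimage_meet b).
Proof. by []. Qed.

(** From right to left, [a] is itself one of the elements whose meet is taken. Conversely, the
    adjunction at [closed_of a] and [closed_of b] puts [b] below the meet of the image of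
    [closedsl a], hence below [f a]. *)
Lemma adjoint_preimage_meet :
  adjoint_pair (closed_image f) (closed_preimage f) ->
  forall b a, (preimage_meet b <= a)%O <-> (b <= f a)%O.
Proof.
move=> [_ _ adj] b a; split=> [hba|bfa]; last exact: bigmeet_lb.
have : (closed_image f (closed_of a) <= closed_of b)%O.
  by apply/adj; rewrite closed_preimage_of le_closed_of.
rewrite le_closed_of => /le_trans; apply.
by apply: bigmeet_lb; exists a => //; exact: lexx.
Qed.

(** By adjointness the preimage of [closedsl b] is exactly [closedsl (h b)]. *)
Lemma preimage_meetE (h : M -> L) :
  (forall b a, (h b <= a)%O <-> (b <= f a)%O) -> preimage_meet = h.
Proof.
move=> hf; apply: funext => b; rewrite -(bigmeet_closedsl (h b)).
by congr bigmeet; apply/seteqP; split=> x /hf.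
Qed.

Lemma closed_image_of a :
  {homo f : x y / (x <= y)%O} -> closed_image f (closed_of a) = closed_of (f a).
Proof.
move=> fmono; congr closed_of; apply: le_anti; apply/andP; split.
  by apply: bigmeet_lb; exists a => //; exact: lexx.
by apply: bigmeet_ge => _ [x ax <-]; exact: fmono.
Qed.

End ClosedImageAdjunction.

Theorem theorem3p1p5 (dL dM : Order.disp_t) (L : frameType dL)
    (M : frameType dM) (f : L -> M) :
  localic_map f <->
  [/\ adjoint_pair (closed_image f) (closed_preimage f),
      closed_preimage f (closed_void M) = closed_void L
    & forall b : M,
        slcompl (val (closed_preimage f (closed_of b))) `<=`
        f @^-1` (opensl b)].
Proof.
split=> [[h [_ hI _ h1] [_ fmono hf]]|[adj cl1 cl_compl]].
  have hE := preimage_meetE f h hf.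
  split=> [||b].
  - apply: adjoint_pair_iff => S T.
    have [[a ->] [b ->]] := (closedSubP S, closedSubP T).
    (* On generators the claim becomes [b <= f a <-> h b <= a]. *)
    rewrite closed_image_of // closed_preimage_of hE !le_closed_of.
    by split=> /hf.
  - by rewrite !closed_voidE closed_preimage_of hE h1.
  - rewrite closed_preimage_of hE slcompl_closedsl.
    exact: (left_adjoint_meetP hf).1.
have hf := adjoint_preimage_meet f adj.
exists (preimage_meet f); last exact: adjoint_pair_iff.
split.
- exact: left_adjoint_bigjoin hf.
- apply/(left_adjoint_meetP hf) => b; rewrite -slcompl_closedsl.
  exact: cl_compl.
- exact: left_adjoint_bot hf.
- by apply: closed_of_inj; rewrite -closed_preimage_of -!closed_voidE.
Qed.
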